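(* Let $k$ be a commutative ring with $1$ and let $A(B)^C$ be a coalgebra-Galois extension over $k$. The extension $B\hookrightarrow A$ is separable if and only if there exists a normalised integral in the canonical entwining structure $(A,C)_\psi$ associated to $A(B)^C$.
   Context: Algebras are associative unital $k$-algebras, coalgebras coassociative counital $k$-coalgebras, $\otimes=\otimes_k$; $\varepsilon_C$ is the counit of $C$. Coalgebra-Galois extension. Let $C$ be a coalgebra, $A$ an algebra and a right $C$-comodule with coaction $\rho^A:A\to A\otimes C$, and let $B=\{b\in A\mid\rho^A(ba)=b\rho^A(a)\text{ for all }a\in A\}$, a subalgebra of $A$. $B\hookrightarrow A$ is a coalgebra-Galois extension, denoted $A(B)^C$, if the map $\mathrm{can}:A\otimes_BA\to A\otimes C$, $a\otimes a'\mapsto a\rho^A(a')$, is bijective. The associated canonical entwining structure is $(A,C)_\psi$ with $\psi:C\otimes A\to A\otimes C$, $\psi(c\otimes a)=\mathrm{can}(\mathrm{can}^{-1}(1_A\otimes c)a)$. An integral in $(A,C)_\psi$ is an element $\mathfrak z=\sum_ia_i\otimes c_i\in A\otimes C$ such that $\sum_iaa_i\otimes c_i=\sum_ia_i\psi(c_i\otimes a)$ for all $a\in A$. It is normalised if $\sum_ia_i\varepsilon_C(c_i)=1$. An extension of algebras $B\hookrightarrow A$ is separable if there exists $u\in A\otimes_BA$ such that $au=ua$ for all $a\in A$ and $\mu_{A,B}(u)=1_A$, where $\mu_{A,B}:A\otimes_BA\to A$ is induced by the product of $A$. *)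

(* Defs.v *)
From HB Require Import structures.
From mathcomp Require Import all_boot all_algebra.
From mathcomp Require Import boolp classical_sets.
From mathcomp Require Import freeg.

Set Implicit Arguments.
Unset Strict Implicit.
Unset Printing Implicit Defensive.

Import GRing.Theory.
Local Open Scope ring_scope.
Local Open Scope quotient_scope.

(* [tensor r l] is the balanced tensor product of the abelian groups M and N  *)
(* over S, where S acts on the right of M by [r] and on the left of N by [l]: *)
(* the free abelian group on M * N modulo the subgroup spanned by the usual   *)
(* relations. Nothing is assumed on S, so this covers both tensor products    *)
(* over k and over a (possibly noncommutative) subring.                       *)
Section Tensor.
Variables (M N : zmodType) (S : Type) (r : M -> S -> M) (l : S -> N -> N).

Inductive tensor_rel : {freeg (M * N)%type} -> Prop :=
| TensorRel0 : tensor_rel 0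
| TensorRelB D E : tensor_rel D -> tensor_rel E -> tensor_rel (D - E)
| TensorRelDl m m' n :
    tensor_rel (<< (m + m', n) >> - << (m, n) >> - << (m', n) >>)
| TensorRelDr m n n' :
    tensor_rel (<< (m, n + n') >> - << (m, n) >> - << (m, n') >>)
| TensorRelS m s n :
    tensor_rel (<< (r m s, n) >> - << (m, l s n) >>).

Definition tensor_sub : {pred {freeg (M * N)%type}} :=
  [pred D | `[< tensor_rel D >]].

Fact tensor_sub_closed : zmod_closed tensor_sub.
Proof.
split=> [|D E /asboolP rD /asboolP rE]; apply/asboolP.
  exact: TensorRel0.
exact: TensorRelB.
Qed.

HB.instance Definition _ :=
  GRing.isZmodClosed.Build {freeg (M * N)%type} tensor_sub tensor_sub_closed.

Definition tensor : Type := Quotient.quot tensor_sub.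
HB.instance Definition _ := GRing.Zmodule.on tensor.

Definition tens (m : M) (n : N) : tensor :=
  \pi_(Quotient.quot tensor_sub) << (m, n) >>.

Record balanced (P : zmodType) (f : M -> N -> P) : Prop := Balanced {
  balancedDl : forall m m' n, f (m + m') n = f m n + f m' n;
  balancedDr : forall m n n', f m (n + n') = f m n + f m n';
  balancedS : forall m s n, f (r m s) n = f m (l s n) }.

(* The additive map tensor -> P sending [tens m n] to [f m n]. It is total in *)
(* [f], through a choice of representatives, but only meaningful when [f] is  *)
(* balanced: see [tens_liftE] and [tens_lift_zmod_morphism].                  *)
Definition tens_lift (P : zmodType) (f : M -> N -> P) (t : tensor) : P :=
  fglift (fun mn => f mn.1 mn.2 : zmodule P)
    (repr (t : Quotient.quot tensor_sub)).

Let piB D E : \pi_(Quotient.quot tensor_sub) (D - E)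
  = \pi_(Quotient.quot tensor_sub) D - \pi_(Quotient.quot tensor_sub) E.
Proof. exact: raddfB. Qed.

Lemma tensDl m m' n : tens (m + m') n = tens m n + tens m' n.
Proof.
apply/eqP; rewrite addrC -subr_eq -piB -Quotient.idealrBE.
exact/asboolP/TensorRelDl.
Qed.

Lemma tensDr m n n' : tens m (n + n') = tens m n + tens m n'.
Proof.
apply/eqP; rewrite addrC -subr_eq -piB -Quotient.idealrBE.
exact/asboolP/TensorRelDr.
Qed.

Lemma tensS m s n : tens (r m s) n = tens m (l s n).
Proof.
apply/eqP; rewrite -Quotient.idealrBE.
exact/asboolP/TensorRelS.
Qed.

Section Lift.
Variables (P : zmodType) (f : M -> N -> P).
Hypothesis bf : balanced f.

Let g : {freeg (M * N)%type} -> P :=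
  fglift (fun mn => f mn.1 mn.2 : zmodule P).

Let gB D E : g (D - E) = g D - g E.
Proof. exact: (lift_is_additive (fun mn => f mn.1 mn.2 : zmodule P)). Qed.

Let g1 m n : g << (m, n) >> = f m n.
Proof. by rewrite /g liftU. Qed.

Let g_rel D : tensor_rel D -> g D = 0.
Proof.
elim=> [|D1 E _ IHD _ IHE|m m' n|m n n'|m s n].
- by have := gB 0 0; rewrite !subrr.
- by rewrite gB IHD IHE subrr.
- by rewrite !gB !g1 (balancedDl bf) addrAC addrK subrr.
- by rewrite !gB !g1 (balancedDr bf) addrAC addrK subrr.
- by rewrite !gB !g1 (balancedS bf) subrr.
Qed.

Let lift_pi D : tens_lift f (\pi_(Quotient.quot tensor_sub) D) = g D.
Proof.
change (tens_lift f _) with (g (repr (\pi_(Quotient.quot tensor_sub) D))).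
apply: subr0_eq; rewrite -gB; apply: g_rel.
by apply/asboolP; rewrite -[asbool _]/(_ \in tensor_sub) Quotient.idealrBE reprK.
Qed.

Lemma tens_liftE m n : tens_lift f (tens m n) = f m n.
Proof. by rewrite lift_pi g1. Qed.

Lemma tens_lift_zmod_morphism : zmod_morphism (tens_lift f).
Proof.
move=> t u; rewrite -[t]reprK -[u]reprK.
by rewrite -piB !lift_pi gB.
Qed.

End Lift.

Lemma tens_ext (P : zmodType) (h h' : tensor -> P) :
  zmod_morphism h -> zmod_morphism h' ->
  (forall m n, h (tens m n) = h' (tens m n)) -> h =1 h'.
Proof.
move=> hB h'B eqh t; apply/eqP; rewrite -subr_eq0 -[t]reprK.
move: (repr _) => D {t}.
pose d D := h (\pi_(Quotient.quot tensor_sub) D)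
            - h' (\pi_(Quotient.quot tensor_sub) D).
have dB E F : d (E - F) = d E - d F.
  by rewrite /d piB hB h'B !opprB addrACA [RHS]addrACA [in RHS](addrC (- _)).
have d0 : d 0 = 0 by rewrite -(subrr 0) dB subrr.
have dN E : d (- E) = - d E by rewrite -sub0r dB d0 sub0r.
have dD E F : d (E + F) = d E + d F by rewrite -{1}[F]opprK dB dN opprK.
have d1 mn : d << mn >> = 0 by case: mn => m n; rewrite /d eqh subrr.
have dMn n mn : d << n%:Z *g mn >> = 0.
  rewrite -[n%:Z]natz -freegU_muln.
  by elim: n => [|n IHn]; rewrite ?mulr0n ?mulrS ?dD ?d1 ?IHn ?addr0.
apply/eqP; rewrite -/(d D) -(freeg_sumE D); elim: (dom D) => [|mn s IHs].
  by rewrite big_nil d0.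
rewrite big_cons dD IHs addr0; case: (coeff mn D) => n; first by rewrite dMn.
by rewrite NegzE -freegUN dN dMn oppr0.
Qed.

End Tensor.

Section TensorK.
Variable k : comPzRingType.

Definition tensk (M N : lmodType k) : Type :=
  tensor (fun (m : M) (c : k) => c *: m) (fun (c : k) (n : N) => c *: n).
HB.instance Definition _ M N := GRing.Zmodule.on (tensk M N).

Definition tk (M N : lmodType k) (m : M) (n : N) : tensk M N := tens _ _ m n.

Section Scale.
Variables M N : lmodType k.
Implicit Types (m : M) (n : N) (c : k) (t : tensk M N).

Lemma tkDl m m' n : tk (m + m') n = tk m n + tk m' n.
Proof. exact: tensDl. Qed.

Lemma tkDr m n n' : tk m (n + n') = tk m n + tk m n'.
Proof. exact: tensDr. Qed.

Lemma tkZ c m n : tk (c *: m) n = tk m (c *: n).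
Proof. exact: (tensS (fun m c => c *: m) (fun c n => c *: n)). Qed.

Definition tensk_scale c t : tensk M N :=
  tens_lift (fun m n => tk (c *: m) n) t.

Fact tensk_scale_balanced c :
  balanced (fun m c => c *: m) (fun c n => c *: n)
    (fun m n => tk (c *: m) n).
Proof.
split=> [m m' n|m n n'|m s n]; rewrite ?scalerDr ?tkDl ?tkDr //.
by rewrite scalerA mulrC -scalerA tkZ.
Qed.

Let scaleE c m n : tensk_scale c (tk m n) = tk (c *: m) n.
Proof. exact/tens_liftE/tensk_scale_balanced. Qed.

Let scaleB c : zmod_morphism (tensk_scale c).
Proof. exact/tens_lift_zmod_morphism/tensk_scale_balanced. Qed.

Fact tensk_scaleA a b t :
  tensk_scale a (tensk_scale b t) = tensk_scale (a * b) t.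
Proof.
move: t; apply: tens_ext => [t u|t u|m n]; rewrite ?scaleB //.
by rewrite -/(tk m n) !scaleE scalerA.
Qed.

Fact tensk_scale1 : left_id 1 tensk_scale.
Proof.
apply: tens_ext => [t u|t u|m n]; rewrite ?scaleB //.
by rewrite -/(tk m n) scaleE scale1r.
Qed.

Fact tensk_scaleDr : right_distributive tensk_scale +%R.
Proof.
move=> c t u; rewrite -{1}[u]opprK scaleB -[- u]sub0r scaleB.
by rewrite -{1}(subrr 0) scaleB subrr sub0r opprK.
Qed.

Fact tensk_scaleDl t : {morph tensk_scale^~ t : a b / a + b}.
Proof.
move=> a b; move: t; apply: tens_ext => [t u|t u|m n].
- by rewrite scaleB.
- by rewrite !scaleB addrACA opprD.
- by rewrite -/(tk m n) !scaleE scalerDl tkDl.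
Qed.

HB.instance Definition _ := GRing.Zmodule_isLmodule.Build k (tensk M N)
  tensk_scaleA tensk_scale1 tensk_scaleDr tensk_scaleDl.

Lemma tkZl c m n : tk (c *: m) n = c *: tk m n.
Proof. by rewrite -scaleE. Qed.

End Scale.

Definition tensk_map (M M' N N' : lmodType k) (f : M -> M') (g : N -> N') :
    tensk M N -> tensk M' N' :=
  tens_lift (fun m n => tk (f m) (g n)).

Definition tensk_assoc (L M N : lmodType k) :
    tensk (tensk L M) N -> tensk L (tensk M N) :=
  tens_lift (fun t n => tens_lift (fun l m => tk l (tk m n)) t).

End TensorK.

HB.mixin Record Lmodule_isCoalgebra (k : comPzRingType) C
    of GRing.Lmodule k C := {
  comul : {linear C -> tensk C C};
  counit : {linear C -> k^o};
  comulA : forall c : C,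
    tensk_assoc (tensk_map comul id (comul c)) = tensk_map id comul (comul c);
  counitl : forall c : C, tens_lift (fun x y => counit x *: y) (comul c) = c;
  counitr : forall c : C, tens_lift (fun x y => counit y *: x) (comul c) = c }.

#[short(type="coalgType")]
HB.structure Definition Coalgebra (k : comPzRingType) :=
  {C of GRing.Lmodule k C & Lmodule_isCoalgebra k C}.

(* [algType k] is restricted to nonzero algebras: [pzAlgType k] is the same   *)
(* notion over [pzRingType], so that the zero algebra is not excluded.        *)
HB.mixin Record PzRing_isPzAlgebra (k : comPzRingType) A of GRing.PzRing A := {
  pz_scale : k -> A -> A;
  pz_scaleA : forall (c d : k) (a : A),
    pz_scale c (pz_scale d a) = pz_scale (c * d) a;
  pz_scale1 : left_id 1 pz_scale;
  pz_scaleDr : right_distributive pz_scale +%R;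
  pz_scaleDl : forall a : A, {morph pz_scale^~ a : c d / c + d};
  pz_scaleAl : forall (c : k) (a b : A),
    pz_scale c (a * b) = pz_scale c a * b;
  pz_scaleAr : forall (c : k) (a b : A),
    pz_scale c (a * b) = a * pz_scale c b }.

#[short(type="pzAlgType")]
HB.structure Definition PzAlgebra (k : comPzRingType) :=
  {A of GRing.PzRing A & PzRing_isPzAlgebra k A}.

#[non_forgetful_inheritance]
HB.instance Definition _ (k : comPzRingType) (A : pzAlgType k) :=
  GRing.Zmodule_isLmodule.Build k (PzAlgebra.sort A)
    pz_scaleA pz_scale1 pz_scaleDr pz_scaleDl.

#[reversible=no]
Coercion PzAlgebra_sort__canonical__GRing_Lmodule :
  PzAlgebra.type >-> GRing.Lmodule.type.

Lemma pz_scalerAl (k : comPzRingType) (A : pzAlgType k) (c : k) (a b : A) :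
  c *: (a * b) = (c *: a) * b.
Proof. exact: pz_scaleAl. Qed.

Lemma pz_scalerAr (k : comPzRingType) (A : pzAlgType k) (c : k) (a b : A) :
  c *: (a * b) = a * (c *: b).
Proof. exact: pz_scaleAr. Qed.

Record is_comodule (k : comPzRingType) (C : coalgType k) (M : lmodType k)
    (rho : {linear M -> tensk M C}) : Prop := IsComodule {
  coactionA : forall m,
    tensk_assoc (tensk_map rho id (rho m)) = tensk_map id comul (rho m);
  coaction_counit : forall m,
    tens_lift (fun x c => counit c *: x) (rho m) = m }.

Section TensorOverSubring.
Variables (A : pzRingType) (B : {pred A}).

Definition tensB : Type :=
  tensor (fun (a : A) (b : {b : A | b \in B}) => a * val b)
    (fun (b : {b : A | b \in B}) (a : A) => val b * a).
HB.instance Definition _ := GRing.Zmodule.on tensB.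

Definition tB (x y : A) : tensB := tens _ _ x y.

Definition tensB_lmul (a : A) : tensB -> tensB :=
  tens_lift (fun x y => tB (a * x) y).

Definition tensB_rmul (u : tensB) (a : A) : tensB :=
  tens_lift (fun x y => tB x (y * a)) u.

Definition tensB_mu : tensB -> A := tens_lift (fun x y => x * y).

(* Meant for B the carrier of a subalgebra of A, as is [coinv] below: see     *)
(* [coinv_subring_closed] and [coinv_scaler_closed].                          *)
Definition separable_extension : Prop :=
  exists u : tensB,
    (forall a, tensB_lmul a u = tensB_rmul u a) /\ tensB_mu u = 1.

Lemma tBDl x x' y : tB (x + x') y = tB x y + tB x' y.
Proof. exact: tensDl. Qed.

Lemma tBDr x y y' : tB x (y + y') = tB x y + tB x y'.
Proof. exact: tensDr. Qed.

Lemma tBM x b y : b \in B -> tB (x * b) y = tB x (b * y).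
Proof.
move=> Bb; exact: (tensS (fun a (b : {b : A | b \in B}) => a * val b)
  (fun (b : {b : A | b \in B}) a => val b * a) x (Sub b Bb) y).
Qed.

Lemma tensB_lmulE a x y : tensB_lmul a (tB x y) = tB (a * x) y.
Proof.
apply: tens_liftE; split=> [m m' n|m n n'|m s n].
- by rewrite mulrDr tBDl.
- by rewrite tBDr.
- by rewrite mulrA tBM ?(valP s).
Qed.

Lemma tensB_lmul_zmod_morphism a : zmod_morphism (tensB_lmul a).
Proof.
apply: tens_lift_zmod_morphism; split=> [m m' n|m n n'|m s n].
- by rewrite mulrDr tBDl.
- by rewrite tBDr.
- by rewrite mulrA tBM ?(valP s).
Qed.

Lemma tensB_rmulE a x y : tensB_rmul (tB x y) a = tB x (y * a).
Proof.
apply: tens_liftE; split=> [m m' n|m n n'|m s n].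
- by rewrite tBDl.
- by rewrite mulrDl tBDr.
- by rewrite -mulrA tBM ?(valP s).
Qed.

Lemma tensB_rmul_zmod_morphism a : zmod_morphism (tensB_rmul^~ a).
Proof.
apply: tens_lift_zmod_morphism; split=> [m m' n|m n n'|m s n].
- by rewrite tBDl.
- by rewrite mulrDl tBDr.
- by rewrite -mulrA tBM ?(valP s).
Qed.

Lemma tensB_muE x y : tensB_mu (tB x y) = x * y.
Proof.
by apply: tens_liftE; split=> *; rewrite ?mulrDl ?mulrDr ?mulrA.
Qed.

End TensorOverSubring.

Section CoalgebraGalois.
Variables (k : comPzRingType) (C : coalgType k) (A : pzAlgType k).

Definition tensk_lmul (a : A) : tensk A C -> tensk A C :=
  tens_lift (fun x c => tk (a * x) c).

Fact tensk_lmul_balanced (a : A) :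
  balanced (fun x s => s *: x) (fun s c => s *: c)
    (fun (x : A) (c : C) => tk (a * x) c).
Proof.
split=> [x x' c|x c c'|x s c]; rewrite ?mulrDr ?tkDl ?tkDr //.
by rewrite -pz_scalerAr tkZ.
Qed.

Lemma tensk_lmulE a x c : tensk_lmul a (tk x c) = tk (a * x) c.
Proof. exact/tens_liftE/tensk_lmul_balanced. Qed.

Lemma tensk_lmul_zmod_morphism a : zmod_morphism (tensk_lmul a).
Proof. exact/tens_lift_zmod_morphism/tensk_lmul_balanced. Qed.

Lemma tensk_lmul1 t : tensk_lmul 1 t = t.
Proof.
move: t; apply: tens_ext => // [|a c]; first exact: tensk_lmul_zmod_morphism.
by rewrite -/(tk a c) tensk_lmulE mul1r.
Qed.

Lemma tensk_lmulM a b t : tensk_lmul (a * b) t = tensk_lmul a (tensk_lmul b t).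
Proof.
move: t; apply: tens_ext => [t u|t u|x c]; rewrite ?tensk_lmul_zmod_morphism //.
by rewrite -/(tk x c) !tensk_lmulE mulrA.
Qed.

Lemma tensk_lmulB a b t : tensk_lmul (a - b) t = tensk_lmul a t - tensk_lmul b t.
Proof.
have tkB (x y : A) (c : C) : tk (x - y) c = tk x c - tk y c.
  by apply/eqP; rewrite eq_sym subr_eq -tkDl subrK.
move: t; apply: tens_ext => [t u|t u|x c]; rewrite ?tensk_lmul_zmod_morphism //.
  by rewrite !opprB addrACA [RHS]addrACA [in RHS](addrC (- _)).
by rewrite -/(tk x c) !tensk_lmulE mulrBl tkB.
Qed.

Lemma tensk_lmulZ s a t : tensk_lmul (s *: a) t = s *: tensk_lmul a t.
Proof.
move: t; apply: tens_ext => [t u|t u|x c].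
- by rewrite tensk_lmul_zmod_morphism.
- by rewrite tensk_lmul_zmod_morphism scalerBr.
by rewrite -/(tk x c) !tensk_lmulE -tkZl -pz_scalerAl.
Qed.

(* For z the sum of the [tk a_i c_i], the right-hand side of [is_integral] is *)
(* the sum of the a_i psi(c_i ⊗ a) as soon as psi is k-linear.                *)
Section Integral.
Variable psi : tensk C A -> tensk A C.

Definition is_integral (z : tensk A C) : Prop :=
  forall a : A,
    tensk_lmul a z = tens_lift (fun x c => tensk_lmul x (psi (tk c a))) z.

Definition is_normalised (z : tensk A C) : Prop :=
  tens_lift (fun (x : A) (c : C) => (counit c : k) *: x) z = 1.

End Integral.

Variable rho : {linear A -> tensk A C}.

Definition coinv : {pred A} :=
  [pred b | `[< forall a, rho (b * a) = tensk_lmul b (rho a) >]].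

Lemma coinv_subring_closed : GRing.subring_closed coinv.
Proof.
split=> [|x y /asboolP xB /asboolP yB|x y /asboolP xB /asboolP yB];
  apply/asboolP => a.
- by rewrite mul1r tensk_lmul1.
- by rewrite mulrBl linearB xB yB tensk_lmulB.
- by rewrite -mulrA xB yB tensk_lmulM.
Qed.

Lemma coinv_scaler_closed (s : k) : {in coinv, forall b, s *: b \in coinv}.
Proof.
move=> b /asboolP bB; apply/asboolP => a.
by rewrite -pz_scalerAl linearZ bB tensk_lmulZ.
Qed.

Definition can : tensB coinv -> tensk A C :=
  tens_lift (fun a a' => tensk_lmul a (rho a')).

Fact can_balanced :
  balanced (fun a (b : {b : A | b \in coinv}) => a * val b)
    (fun (b : {b : A | b \in coinv}) a => val b * a)
    (fun a a' => tensk_lmul a (rho a')).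
Proof.
split=> [a a' x|a x x'|a [b Bb] x] /=.
- by apply/esym/eqP; rewrite eq_sym -subr_eq -tensk_lmulB addrK.
- apply/esym/eqP; rewrite eq_sym -subr_eq.
  by rewrite -tensk_lmul_zmod_morphism raddfD addrK.
- by rewrite tensk_lmulM; move/asboolP: Bb => ->.
Qed.

Lemma canE a a' : can (tB coinv a a') = tensk_lmul a (rho a').
Proof. exact/tens_liftE/can_balanced. Qed.

Lemma can_zmod_morphism : zmod_morphism can.
Proof. exact/tens_lift_zmod_morphism/can_balanced. Qed.

Definition coalgebra_Galois : Prop := is_comodule rho /\ bijective can.

(* The inverse of [can] when [can] is bijective.                              *)
Definition can_inv (t : tensk A C) : tensB coinv :=
  xget 0 [set u | can u = t]%classic.

Definition canonical_entwining : tensk C A -> tensk A C :=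
  tens_lift (fun c a => can (tensB_rmul (can_inv (tk (1 : A) c)) a)).

Section CanBijective.
Hypothesis can_bij : bijective can.

Lemma can_invK : cancel can_inv can.
Proof.
case: can_bij => g _ gK t.
exact: (@xgetPex _ 0 [set u | can u = t]%classic (ex_intro _ (g t) (gK t))).
Qed.

Lemma canK : cancel can can_inv.
Proof. by move=> u; apply: (bij_inj can_bij); rewrite can_invK. Qed.

Lemma can_lmul a u : can (tensB_lmul a u) = tensk_lmul a (can u).
Proof.
move: u; apply: tens_ext => [u v|u v|x y].
- by rewrite tensB_lmul_zmod_morphism can_zmod_morphism.
- by rewrite can_zmod_morphism tensk_lmul_zmod_morphism.
by rewrite -/(tB coinv x y) tensB_lmulE !canE tensk_lmulM.
Qed.

Let rmulB a (u v : tensB coinv) :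
  tensB_rmul (u - v) a = tensB_rmul u a - tensB_rmul v a.
Proof. exact: (@tensB_rmul_zmod_morphism A coinv a). Qed.

Fact canonical_entwining_balanced :
  balanced (fun (c : C) (s : k) => s *: c) (fun s (a : A) => s *: a)
    (fun c a => can (tensB_rmul (can_inv (tk (1 : A) c)) a)).
Proof.
have fD (V W : zmodType) (f : V -> W) : zmod_morphism f ->
    {morph f : x y / x + y}.
  by move=> fB x y; apply/esym/eqP; rewrite eq_sym -subr_eq -fB addrK.
have rmulDr (u : tensB coinv) a b : tensB_rmul u (a + b) = tensB_rmul u a + tensB_rmul u b.
  move: u; apply: tens_ext => [u v|u v|x y].
  - exact: rmulB.
  - by rewrite !rmulB opprD addrACA.
  by rewrite -/(tB coinv x y) !tensB_rmulE mulrDr tBDr.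
have invD : {morph can_inv : t u / t + u}.
  move=> t u; apply: (bij_inj can_bij).
  by rewrite can_invK (fD _ _ can can_zmod_morphism) !can_invK.
split=> [c c' a|c a a'|c s a].
- by rewrite tkDr invD (fD _ _ ((@tensB_rmul A coinv)^~ a) (rmulB a)) (fD _ _ can can_zmod_morphism).
- by rewrite rmulDr (fD _ _ can can_zmod_morphism).
congr can; have s1B : s *: (1 : A) \in coinv.
  by apply/coinv_scaler_closed; case: coinv_subring_closed.
have -> : can_inv (tk (1 : A) (s *: c))
    = tensB_lmul (s *: (1 : A)) (can_inv (tk (1 : A) c)).
  apply: (bij_inj can_bij); rewrite can_lmul !can_invK tensk_lmulE mulr1.
  by rewrite tkZ.
move: (can_inv _); apply: tens_ext => [u v|u v|x y].
- by rewrite tensB_lmul_zmod_morphism rmulB.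
- exact: rmulB.
rewrite -/(tB coinv x y) tensB_lmulE !tensB_rmulE.
have -> : (s *: (1 : A) : A) * x = x * (s *: (1 : A) : A).
  by rewrite -pz_scalerAl -pz_scalerAr mul1r mulr1.
by rewrite tBM // -pz_scalerAl mul1r pz_scalerAr.
Qed.

Lemma canonical_entwiningE c a :
  canonical_entwining (tk c a) = can (tensB_rmul (can_inv (tk (1 : A) c)) a).
Proof. exact/tens_liftE/canonical_entwining_balanced. Qed.

End CanBijective.

End CoalgebraGalois.

(* Main.v *)
Require Import Defs.
From HB Require Import structures.
From mathcomp Require Import all_boot all_algebra.

(** The bijection [can] identifies the elements [u] of A ⊗_B A with the
    elements [z = can u] of A ⊗ C, and it carries each half of separability to
    the corresponding half of the notion of normalised integral.

    It is left A-linear. The right A-action on A ⊗_B A transports to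
    [z ↦ can (can^-1 z * a)], and this is exactly the right-hand side of the
    integral condition: on a pure tensor [x ⊗ c], left linearity gives
    [x psi(c ⊗ a) = x can (can^-1 (1 ⊗ c) a) = can (can^-1 (x ⊗ c) a)]
    ([integral_rhs_can]). So [au = ua] for all [a] if and only if [can u] is
    an integral. In the same way, the counit axiom of the coaction turns
    [id ⊗ counit] into the multiplication map:
    [(id ⊗ counit) (x rho(y)) = x y] ([counit_can]). So [mu u = 1] if and only
    if [can u] is normalised. *)

Set Implicit Arguments.
Unset Strict Implicit.
Unset Printing Implicit Defensive.

Import GRing.Theory.
Local Open Scope ring_scope.

Lemma zmod_morphism_addr (V W : zmodType) (f : V -> W) :
  zmod_morphism f -> {morph f : x y / x + y}.
Proof.
by move=> fB x y; apply/esym/eqP; rewrite eq_sym -subr_eq -fB addrK.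
Qed.

Lemma zmod_morphism_comp (U V W : zmodType) (g : V -> W) (f : U -> V) :
  zmod_morphism g -> zmod_morphism f -> zmod_morphism (fun x => g (f x)).
Proof. by move=> gB fB x y; rewrite fB gB. Qed.

Lemma tensB_lmul_rmul (A : pzRingType) (B : {pred A}) (a b : A) (u : tensB B) :
  tensB_rmul (tensB_lmul a u) b = tensB_lmul a (tensB_rmul u b).
Proof.
move: u; apply: tens_ext => [||x y].
- exact: zmod_morphism_comp (@tensB_rmul_zmod_morphism _ _ b)
    (@tensB_lmul_zmod_morphism _ _ a).
- exact: zmod_morphism_comp (@tensB_lmul_zmod_morphism _ _ a)
    (@tensB_rmul_zmod_morphism _ _ b).
by rewrite -/(tB B x y) !(tensB_lmulE, tensB_rmulE).
Qed.

Section CoalgebraGaloisSeparability.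
Variables (k : comPzRingType) (C : coalgType k) (A : pzAlgType k).

(** [tens_lift] computes only on balanced maps; this is the map defining
    [is_normalised]. *)
Lemma counit_scale_balanced :
  balanced (fun (x : A) (s : k) => s *: x) (fun s (c : C) => s *: c)
    (fun x c => (counit c : k) *: x).
Proof.
split=> [x x' c|x c c'|x s c]; first exact: scalerDr.
  by rewrite raddfD scalerDl.
by rewrite [counit (s *: c)]linearZ scalerA mulrC.
Qed.

Lemma counit_lmul (a : A) (t : tensk A C) :
  tens_lift (fun x c => (counit c : k) *: x) (tensk_lmul a t)
    = a * tens_lift (fun x c => (counit c : k) *: x) t.
Proof.
have epsB := tens_lift_zmod_morphism counit_scale_balanced.
move: t; apply: tens_ext => [||x c].
- exact: zmod_morphism_comp epsB (@tensk_lmul_zmod_morphism _ _ _ a).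
- by move=> t u; rewrite epsB mulrBr.
rewrite -/(tk x c) tensk_lmulE (tens_liftE counit_scale_balanced).
by rewrite (tens_liftE counit_scale_balanced) -pz_scalerAr.
Qed.

Variable rho : {linear A -> tensk A C}.

Lemma counit_can (u : tensB (coinv rho)) : is_comodule rho ->
  tens_lift (fun x c => (counit c : k) *: x) (can u) = tensB_mu u.
Proof.
move=> rhoC; move: u; apply: tens_ext => [||x y].
- apply: zmod_morphism_comp (@can_zmod_morphism _ _ _ rho).
  exact: tens_lift_zmod_morphism counit_scale_balanced.
- by apply: tens_lift_zmod_morphism; split=> *; rewrite ?mulrDl ?mulrDr ?mulrA.
rewrite -/(tB (coinv rho) x y) canE counit_lmul tensB_muE.
by rewrite (coaction_counit rhoC).
Qed.

Hypothesis can_bij : bijective (can (rho := rho)).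

Lemma can_inv_zmod_morphism : zmod_morphism (can_inv rho).
Proof.
move=> t u; apply: (bij_inj can_bij).
by rewrite can_zmod_morphism !(can_invK can_bij).
Qed.

Lemma lmul_canonical_entwining a x c :
  tensk_lmul x (canonical_entwining rho (tk c a))
    = can (tensB_rmul (can_inv rho (tk x c)) a).
Proof.
rewrite (canonical_entwiningE can_bij) -(can_lmul (rho := rho)).
rewrite -tensB_lmul_rmul; congr (can (tensB_rmul _ a)).
apply: (bij_inj can_bij).
by rewrite can_lmul !(can_invK can_bij) tensk_lmulE mulr1.
Qed.

(** Through [can], the right A-action on A ⊗_B A becomes the operation on the
    right of the integral condition. *)
Lemma integral_rhs_can a (u : tensB (coinv rho)) :
  tens_lift (fun x c => tensk_lmul x (canonical_entwining rho (tk c a)))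
    (can u) = can (tensB_rmul u a).
Proof.
pose R t := can (tensB_rmul (can_inv rho t) a).
have RB : zmod_morphism R.
  apply: zmod_morphism_comp (@can_zmod_morphism _ _ _ rho) _.
  exact: zmod_morphism_comp (@tensB_rmul_zmod_morphism _ _ a)
    can_inv_zmod_morphism.
(* The integrand is the restriction to pure tensors of the additive map R,
   hence balanced. *)
have bal : balanced (fun (x : A) (s : k) => s *: x) (fun s (c : C) => s *: c)
    (fun x c => tensk_lmul x (canonical_entwining rho (tk c a))).
  have RD := zmod_morphism_addr RB.
  split=> [x x' c|x c c'|x s c]; rewrite !lmul_canonical_entwining -/(R _).
  - by rewrite tkDl RD.
  - by rewrite tkDr RD.
  - by rewrite tkZ.
rewrite -[u in RHS](canK can_bij) -/(R _); move: (can u).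
apply: tens_ext => // [|x c]; first exact: tens_lift_zmod_morphism.
by rewrite (tens_liftE bal) lmul_canonical_entwining.
Qed.

Lemma is_integral_can (u : tensB (coinv rho)) :
  is_integral (canonical_entwining rho) (can u)
    <-> forall a, tensB_lmul a u = tensB_rmul u a.
Proof.
split=> uA a; last by rewrite integral_rhs_can -can_lmul uA.
by apply: (bij_inj can_bij); rewrite can_lmul uA integral_rhs_can.
Qed.

End CoalgebraGaloisSeparability.

Theorem proposition4p5 (k : comPzRingType) (C : coalgType k) (A : pzAlgType k)
    (rho : {linear A -> tensk A C}) (galois : coalgebra_Galois rho) :
  separable_extension (coinv rho) <->
  exists z : tensk A C,
    is_integral (canonical_entwining rho) z /\ is_normalised z.
Proof.
have [rhoC can_bij] := galois.
split=> [[u [uA mu1]]|[z [zA z1]]].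
  exists (can u); split; first exact/is_integral_can.
  by rewrite /is_normalised counit_can.
exists (can_inv rho z); split; last by rewrite -counit_can // can_invK.
by apply/is_integral_can; rewrite ?can_invK.
Qed.
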